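(* Let $p$ be an odd prime, $q\in\mathbb{C}_p$ with $|q-1|_p<1$, $h\in\mathbb{Z}$ and $\zeta\in T_p$. For $n_1,n_2,k\in\mathbb{Z}_+$ with $n_1+n_2>2k$, $$\int_{\mathbb{Z}_p}B_{k,n_1}(x,q)B_{k,n_2}(x,q)\,q^{(h-1)x}\zeta^x\,d\mu_{-q}(x)=\begin{cases}q^{h+1}\zeta E^{(h)}_{n_1+n_2,q^{-1},\zeta^{-1}}+[2]_q, & k=0,\\[1mm] q^{h+1}\zeta\binom{n_1}{k}\binom{n_2}{k}\sum_{l=0}^{2k}\binom{2k}{l}(-1)^{2k+l}E^{(h)}_{n_1+n_2-l,q^{-1},\zeta^{-1}}, & k\neq0.\end{cases}$$
   Context: $\mathbb{Z}_p$, $\mathbb{C}_p$ denote the $p$-adic integers and the completion of the algebraic closure of $\mathbb{Q}_p$; $\mathbb{Z}_+=\{0,1,2,\dots\}$. $T_p=\bigcup_{n\ge1}\{\zeta\in\mathbb{C}_p:\zeta^{p^n}=1\}$; for $\zeta\in T_p$ and $y\in\mathbb{Z}_p$, $\zeta^y$ is defined by continuity. For $Q\in\mathbb{C}_p$ with $|Q-1|_p<1$ (applied to $Q=q$ and $Q=q^{-1}$), $[x]_Q=\frac{1-Q^x}{1-Q}$ (so $[2]_q=1+q$), and for uniformly differentiable $f:\mathbb{Z}_p\to\mathbb{C}_p$, $\int_{\mathbb{Z}_p}f(x)\,d\mu_{-Q}(x)=\lim_{N\to\infty}\frac{1+Q}{1+Q^{p^N}}\sum_{x=0}^{p^N-1}f(x)(-Q)^x$.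 For $\xi\in T_p$ and $n\in\mathbb{Z}_+$, $E^{(h)}_{n,Q,\xi}(x)=\int_{\mathbb{Z}_p}[x+y]_Q^n\xi^y Q^{(h-1)y}\,d\mu_{-Q}(y)$ and $E^{(h)}_{n,Q,\xi}=E^{(h)}_{n,Q,\xi}(0)$. The $q$-Bernstein polynomials are $B_{k,n}(x,q)=\binom{n}{k}[x]_q^k[1-x]_{q^{-1}}^{n-k}$ for $x\in\mathbb{Z}_p$ and $n,k\in\mathbb{Z}_+$. *)

(* Defs.v *)
From HB Require Import structures.
From mathcomp Require Import all_boot all_order all_algebra.
From mathcomp Require Import boolp classical_sets reals topology normedtype
  sequences.

Set Implicit Arguments.
Unset Strict Implicit.
Unset Printing Implicit Defensive.

Import Order.TTheory GRing.Theory Num.Theory.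
Import numFieldNormedType.Exports.

Local Open Scope classical_set_scope.
Local Open Scope ring_scope.

Record nonarch_abs (R : realType) (K : fieldType) (v : K -> R) : Prop := {
  nabs_ge0 : forall x, 0 <= v x;
  nabs_eq0 : forall x, (v x == 0) = (x == 0);
  nabsM : forall x y, v (x * y) = v x * v y;
  nabsD : forall x y, v (x + y) <= Num.max (v x) (v y) }.

Definition padic_abs (R : realType) (p : nat) (r : rat) : R :=
  if r == 0 then 0
  else p%:R ^+ logn p `|denq r|%N / p%:R ^+ logn p `|numq r|%N.

Definition abs_cauchy (R : realType) (K : fieldType) (v : K -> R)
    (u : nat -> K) : Prop :=
  forall e : R, 0 < e -> exists N : nat, forall m n : nat,
    (N <= m)%N -> (N <= n)%N -> v (u m - u n) < e.

Definition abs_cvg (R : realType) (K : fieldType) (v : K -> R)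
    (F : set_system nat) (u : nat -> K) (l : K) : Prop :=
  (fun n => v (u n - l)) @ F --> (0 : R).

Record is_completion (R : realType) (K L : fieldType) (v : K -> R)
    (w : L -> R) (i : {rmorphism K -> L}) : Prop := {
  completion_abs : nonarch_abs w;
  completion_ext : forall x, w (i x) = v x;
  completion_dense : forall (y : L) (e : R), 0 < e ->
    exists x, w (y - i x) < e;
  completion_complete : forall u : nat -> L, abs_cauchy w u ->
    exists l, abs_cvg w \oo u l }.

Record is_algebraic_closure (K L : fieldType) (i : {rmorphism K -> L}) :
    Prop := {
  alg_closure_algebraic : forall x : L, algebraicOver i x;
  alg_closure_closed : GRing.closed_field_axiom L }.

(* The field C_p, presented by the tower rat -> Q_p -> Q_p^alg -> C_p: Q_p is
   the completion of rat for the p-adic absolute value, Q_p^alg an algebraic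
   closure of Q_p with the (unique) absolute value extending that of Q_p, and
   C_p the completion of Q_p^alg.  These conditions determine the tower up to
   isometric isomorphism. *)
Record padic_complex (R : realType) (p : nat) := PadicComplex {
  Qp : fieldType;
  Qp_abs : Qp -> R;
  Qp_of_rat : {rmorphism rat -> Qp};
  QpP : is_completion (padic_abs R p) Qp_abs Qp_of_rat;
  Qpbar : fieldType;
  Qpbar_abs : Qpbar -> R;
  Qpbar_of_Qp : {rmorphism Qp -> Qpbar};
  QpbarP : is_algebraic_closure Qpbar_of_Qp;
  Qpbar_absP : nonarch_abs Qpbar_abs;
  Qpbar_abs_ext : forall x, Qpbar_abs (Qpbar_of_Qp x) = Qp_abs x;
  Cp :> fieldType;
  Cp_abs : Cp -> R;
  Cp_of_Qpbar : {rmorphism Qpbar -> Cp};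
  CpP : is_completion Qpbar_abs Cp_abs Cp_of_Qpbar } as C.

Section PadicIntegers.
Context (R : realType) (p : nat) (C : padic_complex R p).

Definition padic_int_pred : {pred Qp C} := fun x => Qp_abs x <= 1.

Lemma padic_int_subring_closed : subring_closed padic_int_pred.
Proof.
have V := completion_abs (QpP C).
have v1 : Qp_abs (1 : Qp C) = 1.
  have n0 : Qp_abs (1 : Qp C) != 0 by rewrite (nabs_eq0 V) oner_eq0.
  by apply: (mulfI n0); rewrite -(nabsM V) !mulr1.
have vN x : Qp_abs (- x : Qp C) = Qp_abs x.
  suff vN1 : Qp_abs (- 1 : Qp C) = 1 by rewrite -mulN1r (nabsM V) vN1 mul1r.
  apply/eqP; rewrite -(@eqrXn2 _ 2) ?(nabs_ge0 V) //.
  by rewrite expr1n expr2 -(nabsM V) mulrNN mulr1 v1.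
split; first by rewrite unfold_in /padic_int_pred v1.
- move=> x y; rewrite !unfold_in => hx hy; apply: le_trans (nabsD V _ _) _.
  by rewrite ge_max vN hx hy.
- move=> x y; rewrite !unfold_in => hx hy; rewrite /padic_int_pred (nabsM V).
  by rewrite mulr_ile1 // (nabs_ge0 V).
Qed.

HB.instance Definition _ :=
  GRing.isSubringClosed.Build (Qp C) padic_int_pred padic_int_subring_closed.

Record padic_int := MkPadicInt {
  padic_int_val : Qp C;
  padic_int_valP : padic_int_val \in padic_int_pred }.
HB.instance Definition _ := [isSub for padic_int_val].
HB.instance Definition _ := [Choice of padic_int by <:].
HB.instance Definition _ := [SubChoice_isSubComNzRing of padic_int by <:].

Definition Cp_of_padic_int (x : padic_int) : C :=
  Cp_of_Qpbar C (Qpbar_of_Qp C (padic_int_val x)).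

(* The limit for the absolute value of C_p, with junk value 0 if there is
   none. *)
Definition Cp_lim (F : set_system nat) (u : nat -> C) : C :=
  xget 0 [set l | abs_cvg (@Cp_abs R p C) F u l].

(* The filter of natural numbers tending p-adically to y. *)
Definition nat_nbhs (y : padic_int) : set_system nat :=
  filter_from [set e : R | 0 < e]
    (fun e => [set m : nat | Qp_abs (padic_int_val (m%:R - y)) < e]).

(* a^y for y in Z_p, defined by continuity from the powers with natural
   exponents; meaningful for |a - 1| < 1. *)
Definition padic_pow (a : C) (y : padic_int) : C :=
  Cp_lim (nat_nbhs y) (fun m => a ^+ m).

(* At Q = 1, where the quotient (1 - Q^x) / (1 - Q) is undefined, the value is
   its limit x. *)
Definition qnumber (Q : C) (x : padic_int) : C :=
  if Q == 1 then Cp_of_padic_int x else (1 - padic_pow Q x) / (1 - Q).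

(* Integral with respect to mu_{-Q}; meaningful for uniformly differentiable
   f, for which the limit exists. *)
Definition fermionic_int (Q : C) (f : padic_int -> C) : C :=
  Cp_lim \oo (fun N : nat =>
    (1 + Q) / (1 + Q ^+ (p ^ N)) *
      \sum_(0 <= x < p ^ N) f x%:R * (- Q) ^+ x).

Definition Tp : set C :=
  [set z | exists2 n : nat, (1 <= n)%N & z ^+ (p ^ n) = 1].

Definition euler_poly (h : int) (n : nat) (Q xi : C) (x : padic_int) : C :=
  fermionic_int Q (fun y =>
    qnumber Q (x + y) ^+ n * padic_pow xi y * padic_pow Q ((h - 1)%:~R * y)).

Definition euler_number (h : int) (n : nat) (Q xi : C) : C :=
  euler_poly h n Q xi 0.

Definition bernstein (k n : nat) (x : padic_int) (q : C) : C :=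
  'C(n, k)%:R * qnumber q x ^+ k * qnumber q^-1 (1 - x) ^+ (n - k).

End PadicIntegers.

(* Main.v *)
Require Import Defs.
From mathcomp Require Import all_boot all_order all_algebra.
From mathcomp Require Import boolp classical_sets reals topology normedtype
  sequences.
From mathcomp Require Import ring zify.
Import Order.TTheory GRing.Theory Num.Theory.
Import numFieldNormedType.Exports.
Set Implicit Arguments.
Unset Strict Implicit.
Unset Printing Implicit Defensive.
Local Open Scope classical_set_scope.
Local Open Scope ring_scope.

(* Since q ^ (p ^ N) -> 1 and |2| = 1, the integral with respect to mu_{-q} of f
   is (1 + q) / 2 times J (x |-> f x * q ^ x), where J F is the limit of the
   alternating sums of F over x < p ^ N.  As p is odd and the absolute value is
   ultrametric, J F exists for every uniformly continuous F, and satisfies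
   J (F (. + 1)) = 2 F 0 - J F.  Reversing the order of summation then gives
   J (F (1 - .)) = J (F (. + 2)) = J F + 2 (F 1 - F 0).  Under x |-> 1 - x the
   factor [x]_q becomes 1 - [x]_{1/q}, so expanding its power 2 k turns the
   reflected integrand into a combination of those of the Euler numbers; the
   boundary term F 0 vanishes because n1 + n2 > 2 k, while F 1 is nonzero only
   for k = 0 and contributes [2]_q. *)

(** * Ultrametric estimates and limits for a nonarchimedean absolute value *)

Section NonarchimedeanAbsoluteValue.
Context (R : realType) (K : fieldType) (v : K -> R) (vP : nonarch_abs v).

Lemma nabs0 : v 0 = 0.
Proof. by apply/eqP; rewrite (nabs_eq0 vP). Qed.

Lemma nabs1 : v 1 = 1.
Proof.
have n0 : v 1 != 0 by rewrite (nabs_eq0 vP) oner_eq0.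
by apply: (mulfI n0); rewrite -(nabsM vP) !mulr1.
Qed.

Lemma nabsN x : v (- x) = v x.
Proof.
suff vN1 : v (- 1) = 1 by rewrite -mulN1r (nabsM vP) vN1 mul1r.
apply/eqP; rewrite -(@eqrXn2 _ 2) ?(nabs_ge0 vP) //.
by rewrite expr1n expr2 -(nabsM vP) mulrNN mulr1 nabs1.
Qed.

Lemma nabs_distC x y : v (x - y) = v (y - x).
Proof. by rewrite -nabsN opprB. Qed.

Lemma nabsX n x : v (x ^+ n) = v x ^+ n.
Proof. by elim: n => [|n IHn]; rewrite ?nabs1 // !exprS (nabsM vP) IHn. Qed.

Lemma nabsV x : v x^-1 = (v x)^-1.
Proof.
have [->|x0] := eqVneq x 0; first by rewrite invr0 nabs0 invr0.
have vx0 : v x != 0 by rewrite (nabs_eq0 vP).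
by apply: (mulfI vx0); rewrite -(nabsM vP) !divff // nabs1.
Qed.

Lemma nabsD_le e x y : v x <= e -> v y <= e -> v (x + y) <= e.
Proof. by move=> xe ye; apply: le_trans (nabsD vP _ _) _; rewrite ge_max xe ye.
  Qed.

Lemma nabsD_lt e x y : v x < e -> v y < e -> v (x + y) < e.
Proof. by move=> xe ye; apply: le_lt_trans (nabsD vP _ _) _;
  rewrite gt_max xe ye. Qed.

Lemma nabsB_lt e x y z : v (x - y) < e -> v (y - z) < e -> v (x - z) < e.
Proof. by move=> xy yz; rewrite -(subrKA y); apply: nabsD_lt. Qed.

Lemma nabs_sum_le (I : Type) (r : seq I) (F : I -> K) e :
  0 <= e -> (forall i, v (F i) <= e) -> v (\sum_(i <- r) F i) <= e.
Proof.
move=> e0 Fe; elim/big_rec: _ => [|i x _ xe]; first by rewrite nabs0.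
exact: nabsD_le.
Qed.

Lemma nabs_sum_lt (I : Type) (r : seq I) (F : I -> K) e :
  0 < e -> (forall i, v (F i) < e) -> v (\sum_(i <- r) F i) < e.
Proof.
move=> e0 Fe; elim/big_rec: _ => [|i x _ xe]; first by rewrite nabs0.
exact: nabsD_lt.
Qed.

Lemma nabs_eq_dist x y : (forall e, 0 < e -> v (x - y) < e) -> x = y.
Proof.
move=> xy; apply/eqP; rewrite -subr_eq0 -(nabs_eq0 vP) eq_le (nabs_ge0 vP).
by rewrite andbT leNgt; apply/negP => /xy; rewrite ltxx.
Qed.

Lemma nabs_nat n : v n%:R <= 1.
Proof.
elim: n => [|n IHn]; first by rewrite nabs0.
by rewrite -natr1; apply: nabsD_le => //; rewrite nabs1.
Qed.

Lemma nabs_int (m : int) : v m%:~R <= 1.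
Proof. by case: m => n; rewrite ?NegzE ?mulrNz ?nabsN; apply: nabs_nat. Qed.

(** If |x + y| were below |x|, then x = (x + y) - y would have absolute value below |x|. *)
Lemma nabsD_eq x y : v y < v x -> v (x + y) = v x.
Proof.
move=> yx; apply: le_anti; rewrite nabsD_le //= ?(ltW yx) //.
rewrite leNgt; apply/negP => xyx.
by move: (nabsD_lt xyx (e := v x) (y := - y));
  rewrite nabsN addrK ltxx => /(_ yx).
Qed.

Lemma nabs_near1 x : v (x - 1) < 1 -> v x = 1.
Proof.
by move=> x1; rewrite -(subrK 1 x) addrC nabsD_eq nabs1.
Qed.

(** In the factorisation of [x ^+ n - 1] by [x - 1], the cofactor is a sum of powers of [x], of
    absolute value at most 1. *)
Lemma nabs_subX1 x n : v x <= 1 -> v (x ^+ n - 1) <= v (x - 1).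
Proof.
move=> x1; rewrite -{1}(expr1n K n) subrXX (nabsM vP) ler_piMr
  ?(nabs_ge0 vP) //.
apply: nabs_sum_le => // i.
by rewrite expr1n mulr1 nabsX exprn_ile1 ?(nabs_ge0 vP).
Qed.

Lemma abs_cvgP (F : set_system nat) (FF : Filter F) u l :
  abs_cvg v F u l <-> forall e, 0 < e -> F [set n | v (u n - l) < e].
Proof.
rewrite /abs_cvg; split.
  move=> /cvgr0Pnorm_lt ul e e0; apply: filterS (ul e e0) => n /=.
  by rewrite ger0_norm ?(nabs_ge0 vP).
move=> ul; apply/cvgr0Pnorm_lt => e e0; apply: filterS (ul e e0) => n /=.
by rewrite ger0_norm ?(nabs_ge0 vP).
Qed.

Lemma abs_cvg_unique (F : set_system nat) (FF : ProperFilter F) u l l' :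
  abs_cvg v F u l -> abs_cvg v F u l' -> l = l'.
Proof.
move=> /abs_cvgP ul /abs_cvgP ul'; apply: nabs_eq_dist => e e0.
have [n [/= nl nl']] := filter_ex (filterI (ul e e0) (ul' e e0)).
by apply: nabsB_lt nl'; rewrite nabs_distC.
Qed.

Lemma abs_cvgooP u l :
  abs_cvg v \oo u l <->
  forall e, 0 < e -> exists N, forall n, (N <= n)%N -> v (u n - l) < e.
Proof.
split=> [/abs_cvgP ul e e0|ul].
  by have [N _ uN] := ul e e0; exists N => n Nn; apply: uN.
by apply/abs_cvgP => e /ul [N uN]; exists N.
Qed.

(** The ultrametric inequality bounds any difference [u n - u N] by the largest consecutive one in
    between. *)
Lemma nabs_cauchy u :
  (forall e, 0 < e -> exists N, forall n, (N <= n)%N -> v (u n.+1 - u n) < e) ->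
  abs_cauchy v u.
Proof.
move=> uS e e0; have [N uN] := uS e e0.
have from n : (N <= n)%N -> v (u n - u N) < e.
  elim: n => [|n IHn]; first by rewrite leqn0 => /eqP ->; rewrite subrr nabs0.
  rewrite leq_eqVlt => /predU1P[->|]; first by rewrite subrr nabs0.
  by rewrite ltnS => Nn; apply: nabsB_lt (uN n Nn) (IHn Nn).
by exists N => m n /from Nm /from Nn; apply: nabsB_lt Nm _; rewrite nabs_distC.
Qed.

Lemma abs_cvgD u1 u2 l1 l2 : abs_cvg v \oo u1 l1 -> abs_cvg v \oo u2 l2 ->
  abs_cvg v \oo (fun n => u1 n + u2 n) (l1 + l2).
Proof.
move=> /abs_cvgooP u1l /abs_cvgooP u2l; apply/abs_cvgooP => e e0.
have [N1 uN1] := u1l e e0; have [N2 uN2] := u2l e e0.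
exists (maxn N1 N2) => n; rewrite geq_max => /andP[N1n N2n].
by rewrite opprD addrACA; apply: nabsD_lt; [apply: uN1 | apply: uN2].
Qed.

Lemma abs_cvg_cst l : abs_cvg v \oo (fun=> l) l.
Proof. by apply/abs_cvgooP => e e0; exists 0%N => n _; rewrite subrr nabs0. Qed.

Lemma abs_cvgM u1 u2 l1 l2 : abs_cvg v \oo u1 l1 -> abs_cvg v \oo u2 l2 ->
  abs_cvg v \oo (fun n => u1 n * u2 n) (l1 * l2).
Proof.
move=> /abs_cvgooP u1l /abs_cvgooP u2l; apply/abs_cvgooP => e e0.
pose M1 := v l1 + 1; pose M2 := v l2 + 1.
have M1_gt0 : 0 < M1 by rewrite ltr_wpDl ?(nabs_ge0 vP).
have M2_gt0 : 0 < M2 by rewrite ltr_wpDl ?(nabs_ge0 vP).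
(* The 1 in the minimum keeps [v (u1 n)] at most [M1]; the other bound pays for the factor [l2]. *)
have [N1 uN1] := u1l (Num.min 1 (e / M2)) ltac:(by rewrite lt_min ltr01
  divr_gt0).
have [N2 uN2] := u2l (e / M1) ltac:(by rewrite divr_gt0).
exists (maxn N1 N2) => n; rewrite geq_max => /andP[/uN1 + /uN2 d2].
rewrite lt_min => /andP[d1 d1'].
have -> : u1 n * u2 n - l1 * l2 = u1 n * (u2 n - l2) + (u1 n - l1) * l2.
  by rewrite mulrBr mulrBl subrKA.
apply: nabsD_lt; rewrite (nabsM vP).
  have le1 : v (u1 n) <= M1.
    rewrite -(subrK l1 (u1 n)); apply: nabsD_le.
      by rewrite (le_trans (ltW d1)) // lerDr (nabs_ge0 vP).
    by rewrite lerDl.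
  rewrite (le_lt_trans (ler_wpM2r _ le1)) ?(nabs_ge0 vP) // mulrC.
  by rewrite -ltr_pdivlMr.
have le2 : v l2 <= M2 by rewrite lerDl.
rewrite (le_lt_trans (ler_wpM2l _ le2)) ?(nabs_ge0 vP) //.
by rewrite -ltr_pdivlMr.
Qed.

Lemma abs_cvg_dist0 u1 u2 l : abs_cvg v \oo u1 l ->
  abs_cvg v \oo (fun n => u2 n - u1 n) 0 -> abs_cvg v \oo u2 l.
Proof.
move=> u1l /(abs_cvgD u1l); rewrite addr0; congr abs_cvg.
by apply/funext => n; rewrite addrC subrK.
Qed.

End NonarchimedeanAbsoluteValue.

Lemma expr_eventually_lt (R : realType) (c e : R) :
  0 <= c < 1 -> 0 < e -> exists N, forall n, (N <= n)%N -> c ^+ n < e.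
Proof.
move=> /andP[c0 c1] e0; have := @cvg_expr R c; rewrite ger0_norm // => /(_ c1).
move=> /cvgr0Pnorm_lt /(_ e e0) [N _ cN]; exists N => n Nn.
by have := cN n Nn; rewrite /= ger0_norm ?exprn_ge0.
Qed.

(** * Natural numbers in Z_p: divisibility by powers of p, and density *)

Section PadicIntegers.
Context (R : realType) (p : nat) (p_prime : prime p) (C : padic_complex R p).
Implicit Types (x y z : padic_int C) (N : nat).

Let QpV := completion_abs (QpP C).
Let p_gt0 : 0 < p%:R :> R. Proof. by rewrite ltr0n prime_gt0. Qed.

Lemma pinv_lt1 : 0 <= (p%:R^-1 : R) < 1.
Proof. by rewrite invr_ge0 ler0n invf_lt1 // ltr1n prime_gt1. Qed.

Lemma Qp_abs_nat m : (0 < m)%N -> Qp_abs (m%:R : Qp C) = p%:R^-1 ^+ logn p m.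
Proof.
move=> m0; rewrite -(rmorph_nat (Qp_of_rat C)) (completion_ext (QpP C)).
rewrite /padic_abs pnatr_eq0 -[(_ == _)]negbK -lt0n m0 /=.
by rewrite (pmulrn 1 m) numq_int denq_int logn1 expr0 div1r exprVn.
Qed.

Lemma Cp_abs_padic_int x : Cp_abs (Cp_of_padic_int x) = Qp_abs (val x).
Proof. by rewrite (completion_ext (CpP C)) Qpbar_abs_ext. Qed.

Lemma Cp_of_padic_intB x y :
  Cp_of_padic_int (x - y) = Cp_of_padic_int x - Cp_of_padic_int y.
Proof. by rewrite /Cp_of_padic_int -!rmorphB. Qed.

Lemma Cp_of_padic_int_nat n : Cp_of_padic_int (n%:R : padic_int C) = n%:R.
Proof.
have valn : padic_int_val (n%:R : padic_int C) = n%:R.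
  exact: (rmorph_nat (val : padic_int C -> Qp C)).
by rewrite /Cp_of_padic_int valn !rmorph_nat.
Qed.

Lemma padic_int_abs_le1 x : Qp_abs (val x) <= 1.
Proof. exact: (valP x). Qed.

Lemma dvdn_Qp_abs m N :
  Qp_abs (m%:R : Qp C) <= p%:R^-1 ^+ N -> (p ^ N %| m)%N.
Proof.
have [->|m0] := posnP m; first by rewrite dvdn0.
have /andP[pi0 pi1] := pinv_lt1.
by rewrite Qp_abs_nat // pfactor_dvdn // ler_iXn2l // invr_gt0.
Qed.

Lemma pabs_distC x y : Qp_abs (val (x - y)) = Qp_abs (val (y - x)).
Proof. by rewrite !rmorphB (nabs_distC QpV). Qed.

Lemma pabsD_lt e x y : Qp_abs (val x) < e -> Qp_abs (val y) < e ->
  Qp_abs (val (x + y)) < e.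
Proof. by rewrite rmorphD; apply: (nabsD_lt QpV). Qed.

Lemma pabsMl_le x y : Qp_abs (val (x * y)) <= Qp_abs (val y).
Proof.
by rewrite rmorphM (nabsM QpV) ler_piMl ?(nabs_ge0 QpV) ?padic_int_abs_le1.
Qed.

Lemma pabs_natX N : Qp_abs (val ((p ^ N)%:R : padic_int C)) = p%:R^-1 ^+ N.
Proof.
rewrite (rmorph_nat (val : padic_int C -> Qp C)).
by rewrite Qp_abs_nat ?expn_gt0 ?prime_gt0 // pfactorK.
Qed.

(** A rational [r] close to [y] satisfies |r| <= 1, so its denominator is invertible modulo [p ^ N]
    and [r] is congruent there to a natural number. *)
Lemma padic_int_nat_dense_pow y N :
  exists m, Qp_abs (val (m%:R - y)) <= p%:R^-1 ^+ N.
Proof.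
have pNV_gt0 : 0 < p%:R^-1 ^+ N :> R by rewrite exprn_gt0 // invr_gt0.
have [r yr] := completion_dense (QpP C) (val y) pNV_gt0.
have pNV_le1 : p%:R^-1 ^+ N <= 1 :> R.
  by case/andP: pinv_lt1 => *; rewrite exprn_ile1 // ltW.
have r1 : padic_abs R p r <= 1.
  rewrite -(completion_ext (QpP C)) -(subKr (val y) (Qp_of_rat C r)).
  apply: (nabsD_le QpV); first exact: padic_int_abs_le1.
  by rewrite (nabsN QpV) (le_trans (ltW yr)).
(* If p divided the denominator it would not divide the numerator, and |r| would exceed 1. *)
have den_coprime : coprime `|denq r| (p ^ N).
  apply: coprimeXr; rewrite coprime_sym prime_coprime //; apply/negP => pr.
  have : ~~ (p %| `|numq r|)%N.
    apply/negP => pn; move: (coprime_num_den r); rewrite /coprime => /eqP rc.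
    have : (p %| 1)%N by rewrite -rc dvdn_gcd pn.
    by rewrite dvdn1 => /eqP p1; move: p_prime; rewrite p1.
  move=> pn; move: r1; rewrite /padic_abs.
  case: eqVneq => [r0|r0]; first by move: pr; rewrite r0 dvdn1 => /eqP p1;
    move: p_prime; rewrite p1.
  rewrite (lognE p `|numq r|) (negbTE pn) !andbF expr0 divr1 leNgt exprn_egt1
    //.
    by rewrite -lt0n logn_gt0 mem_primes p_prime pr absz_gt0 denq_neq0.
  by rewrite ltr1n prime_gt1.
(* With [u * denq r + w * p ^ N = 1], the integer [numq r * u] is at distance at
   most [p ^- N] from [r]. *)
have [u [w uw]] := Bezoutz (denq r) (p ^ N)%N.
have {}uw : u * denq r + w * (p ^ N)%N = 1.
  by rewrite uw /gcdz -/(coprime _ _); move/eqP: den_coprime => /= ->.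
(* The second summand of [t] only makes it nonnegative. *)
pose a : int := numq r * u; pose t : int := a + (p ^ N)%N%:Z * `|a|.
have t0 : 0 <= t.
  rewrite /t -lerBlDl sub0r (le_trans (ler_norm _)) // normrN ler_peMl //.
  by rewrite lez_nat expn_gt0 prime_gt0.
have rE : r = a%:~R + (p ^ N)%:R * (w%:~R * r).
  have d0 : (denq r)%:~R != 0 :> rat by rewrite intr_eq0 denq_neq0.
  have rd : r * (denq r)%:~R = (numq r)%:~R by rewrite -{1}[r]divq_num_den
    divfK.
  apply: (mulIf d0); rewrite mulrDl -!mulrA rd.
  rewrite -[(p ^ N)%:R]/((p ^ N)%N%:~R) -!intrM -intrD.
  congr (_%:~R).
  rewrite -[LHS]mulr1 -uw /a; ring.
exists `|t|%N; rewrite rmorphB rmorph_nat.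
  rewrite (pmulrn 1 `|t|) gez0_abs // /t intrD intrM.
  rewrite -(rmorph_int (Qp_of_rat C) a).
  have -> : a%:~R = r - (p ^ N)%:R * (w%:~R * r).
    by apply/eqP; rewrite eq_sym subr_eq -rE.
  rewrite rmorphB rmorphM rmorph_nat /=; set s := Qp_of_rat C (_ * _).
  have -> : Qp_of_rat C r - (p ^ N)%:R * s + (p ^ N)%:R * `|a|%:~R -
    padic_int_val y = Qp_of_rat C r - padic_int_val y + (p ^ N)%:R * (`|a|%:~R
      - s).
    by ring.
  apply: (nabsD_le QpV); first by rewrite (nabs_distC QpV) ltW.
  rewrite (nabsM QpV) Qp_abs_nat ?expn_gt0 ?prime_gt0 // pfactorK //.
  rewrite ler_piMr ?(ltW pNV_gt0) //; apply: (nabsD_le QpV).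
    exact: nabs_int.
  rewrite (nabsN QpV) /s rmorphM (nabsM QpV) rmorph_int.
  by rewrite mulr_ile1 ?(nabs_ge0 QpV) ?(nabs_int QpV)
    ?(completion_ext (QpP C)).
Qed.

Lemma padic_int_nat_dense y d : 0 < d -> exists m, Qp_abs (val (m%:R - y)) < d.
Proof.
move=> d0; have [N Nd] := expr_eventually_lt pinv_lt1 d0.
have [m my] := padic_int_nat_dense_pow y N.
by exists m; apply: le_lt_trans my (Nd N _).
Qed.
End PadicIntegers.

(** * Powers with exponents in Z_p *)

Section PadicPowers.
Context (R : realType) (p : nat) (p_prime : prime p) (C : padic_complex R p).
Implicit Types (x y z : padic_int C) (N : nat) (a : C).

Let CpV := completion_abs (CpP C).

Lemma Cp_lim_unique (F : set_system nat) (FF : ProperFilter F) (u : nat ->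
  C) l :
  abs_cvg (@Cp_abs R p C) F u l -> Cp_lim F u = l.
Proof.
by move=> ul; apply: xget_unique => // l' ul';
  apply: (abs_cvg_unique CpV) ul' ul.
Qed.

(** Properness is the density of the natural numbers in Z_p; it makes limits along this filter
    unique. *)
#[local] Instance nat_nbhs_filter y : ProperFilter (nat_nbhs y).
Proof.
apply: filter_from_proper.
  apply: filter_from_filter; first by exists 1; apply: ltr01.
  move=> d e d0 e0; exists (Num.min d e) => [|m /=];
    first by rewrite /= lt_min d0 e0.
  by rewrite lt_min => /andP.
by move=> d d0; have [m] := padic_int_nat_dense p_prime y d0; exists m.
Qed.

(* The bases a for which y |-> a ^ y extends continuously from the natural
   numbers to Z_p. *)
Definition padic_base a :=
  abs_cvg (@Cp_abs R p C) \oo (fun N => a ^+ (p ^ N)) 1.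

(** Some [a ^+ (p ^ N)] lies within distance less than 1 of 1, so a positive power of |a| equals
    1. *)
Lemma padic_base_abs a : padic_base a -> Cp_abs a = 1.
Proof.
move=> /(abs_cvgooP CpV) /(_ 1 ltr01) [N /(_ N (leqnn _)) /(nabs_near1 CpV)].
rewrite (nabsX CpV) => aN; apply/eqP.
by rewrite -(@pexpr_eq1 _ _ (p ^ N)) ?aN ?(nabs_ge0 CpV) // expn_gt0 prime_gt0.
Qed.

Lemma padic_base_neq0 a : padic_base a -> a != 0.
Proof. by move=> /padic_base_abs a1; rewrite -(nabs_eq0 CpV) a1 oner_neq0. Qed.

Lemma Cp_abs_nat m : Cp_abs (m%:R : C) = Qp_abs (m%:R : Qp C).
Proof.
by rewrite -Cp_of_padic_int_nat Cp_abs_padic_int (rmorph_nat (val : padic_int C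
  -> Qp C)).
Qed.

(* [a ^ p - 1] is [a - 1] times [p + \sum_(i < p) (a ^ i - 1)], so its absolute
   value is at most [max(|a - 1|, 1 / p)] times that of [a - 1]. *)
Lemma padic_base_near1 a : Cp_abs (a - 1) < 1 -> padic_base a.
Proof.
move=> a1; have /andP[pi0 pi1] := pinv_lt1 R p_prime.
pose c := Num.max (Cp_abs (a - 1)) p%:R^-1.
have c0 : 0 <= c by rewrite le_max pi0 orbT.
have c1 : c < 1 by rewrite gt_max a1 pi1.
have step (b : C) : Cp_abs (b - 1) <= c ->
  Cp_abs (b ^+ p - 1) <= Cp_abs (b - 1) * c.
  move=> bc; rewrite subrX1 (nabsM CpV) ler_wpM2l ?(nabs_ge0 CpV) //.
  have b1 : Cp_abs b <= 1 by rewrite (nabs_near1 CpV) // (le_lt_trans bc).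
  have -> : \sum_(i < p) b ^+ i = \sum_(i < p) (b ^+ i - 1) + p%:R.
    by rewrite sumrB sumr_const card_ord subrK.
  apply: (nabsD_le CpV); last first.
    by rewrite Cp_abs_nat Qp_abs_nat ?prime_gt0 // logn_prime // eqxx expr1
      le_max lexx orbT.
  by apply: (nabs_sum_le CpV) => // i; apply: le_trans (nabs_subX1 CpV _ b1) bc.
have bound N : Cp_abs (a ^+ (p ^ N) - 1) <= c ^+ N.+1.
  elim: N => [|N IHN]; first by rewrite expn0 !expr1 le_max lexx.
  rewrite expnSr exprM (le_trans (step _ _)) //.
    by rewrite (le_trans IHN) // exprS ler_piMr // exprn_ile1 // ltW.
  by rewrite (exprSr c N.+1) ler_wpM2r.
apply/(abs_cvgooP CpV) => e e0.
have [|N cN] := @expr_eventually_lt R c e _ e0; first by rewrite c0 c1.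
by exists N => n Nn; apply: le_lt_trans (bound n) (cN _ (leqW Nn)).
Qed.

Lemma padic_base_Tp a : Tp a -> padic_base a.
Proof.
case=> n _ an; apply/(abs_cvgooP CpV) => e e0; exists n => m nm.
by rewrite -(subnKC nm) expnD exprM an expr1n subrr (nabs0 CpV).
Qed.

Lemma padic_baseV a : padic_base a -> padic_base a^-1.
Proof.
move=> aP; have a1 := padic_base_abs aP; have a0 := padic_base_neq0 aP.
have /(abs_cvgooP CpV) aN := aP.
apply/(abs_cvgooP CpV) => e /aN [N {}aN]; exists N => n /aN.
have -> : a^-1 ^+ (p ^ n) - 1 = a^-1 ^+ (p ^ n) * (1 - a ^+ (p ^ n)).
  by rewrite mulrBr mulr1 exprVn mulVf // expf_neq0.
by rewrite (nabsM CpV) (nabsX CpV) (nabsV CpV) a1 invr1 expr1n mul1r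
  (nabs_distC CpV).
Qed.

(** Uniform continuity of [m |-> a ^+ m] for the p-adic distance: if [p ^ N] divides [m - n], then
    [a ^+ m - a ^+ n] is a unit times a power of [a ^+ (p ^ N)] minus 1. *)
Lemma padic_base_cauchy a e : padic_base a -> 0 < e ->
  exists2 d, 0 < d & forall m n,
    Qp_abs (val (m%:R - n%:R : padic_int C)) < d ->
      Cp_abs (a ^+ m - a ^+ n) < e.
Proof.
move=> aP e0; have a1 := padic_base_abs aP.
have [N aN] := (abs_cvgooP CpV _ _).1 aP e e0.
have /andP[pi0 pi1] := pinv_lt1 R p_prime.
exists (p%:R^-1 ^+ N); first by rewrite exprn_gt0 // invr_gt0 ltr0n prime_gt0.
move=> m n; wlog nm : m n / (n <= m)%N => [H|].
  have [nm|/ltnW mn] := leqP n m; first exact: H.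
  by rewrite pabs_distC (nabs_distC CpV); apply: H.
rewrite -natrB // (rmorph_nat (val : padic_int C -> Qp C)) => /ltW.
move=> /(dvdn_Qp_abs p_prime) /dvdnP [k mn].
have -> : a ^+ m - a ^+ n = a ^+ n * ((a ^+ (p ^ N)) ^+ k - 1).
  by rewrite mulrBr mulr1 -exprM -exprD mulnC -mn subnKC.
rewrite (nabsM CpV) (nabsX CpV) a1 expr1n mul1r.
apply: le_lt_trans (aN N (leqnn N)); apply: (nabs_subX1 CpV).
by rewrite (nabsX CpV) a1 expr1n.
Qed.

Lemma padic_pow_cvg a y : padic_base a ->
  abs_cvg (@Cp_abs R p C) (nat_nbhs y) (fun m => a ^+ m) (padic_pow a y).
Proof.
move=> aP; have /andP[pi0 pi1] := pinv_lt1 R p_prime.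
have dpos N : 0 < p%:R^-1 ^+ N :> R by rewrite exprn_gt0 // invr_gt0 ltr0n
  prime_gt0.
(* Completeness of C_p is available for sequences only, so a limit [l] is first found along naturals
   [m N] tending to [y], then transferred to the filter. *)
pose m N := projT1 (cid (padic_int_nat_dense p_prime y (dpos N))).
have mP N : Qp_abs (val ((m N)%:R - y)) < p%:R^-1 ^+ N by rewrite /m; case: cid.
have close d : 0 < d -> exists N, forall n, (N <= n)%N ->
  Qp_abs (val ((m n)%:R - y)) < d.
  move=> d0; have [|N Nd] := @expr_eventually_lt R p%:R^-1 d _ d0.
    exact: pinv_lt1.
  by exists N => n /Nd; apply: lt_trans.
have [l ml] : exists l, abs_cvg (@Cp_abs R p C) \oo (fun N => a ^+ m N) l.
  apply: (completion_complete (CpP C)) => e e0.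
  have [d d0 ad] := padic_base_cauchy aP e0; have [N Nd] := close d d0.
  exists N => i j /Nd di /Nd dj; apply: ad; rewrite -(subrKA y).
  by apply: pabsD_lt => //; rewrite pabs_distC.
suff al : abs_cvg (@Cp_abs R p C) (nat_nbhs y) (fun m => a ^+ m) l.
  by rewrite /padic_pow (Cp_lim_unique _ al).
apply/(abs_cvgP CpV) => e e0.
have [d d0 ad] := padic_base_cauchy aP e0; exists d => // k /= kd.
have [N1 Nd] := close d d0; have [N2 Nl] := (abs_cvgooP CpV _ _).1 ml e e0.
have N1l := leq_maxl N1 N2; have N2l := leq_maxr N1 N2.
apply: (nabsB_lt CpV) (Nl _ N2l); apply: ad; rewrite -(subrKA y).
by apply: pabsD_lt => //; rewrite pabs_distC; apply: Nd.
Qed.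

(** Here [d] is uniform in [m] and [y]. This is the tool that carries the laws of exponents, and
    uniform continuity, from natural exponents to Z_p. *)
Lemma padic_pow_approx a e : padic_base a -> 0 < e ->
  exists2 d, 0 < d & forall m y,
    Qp_abs (val (m%:R - y)) < d -> Cp_abs (a ^+ m - padic_pow a y) < e.
Proof.
move=> aP e0; have [d d0 ad] := padic_base_cauchy aP e0.
exists d => // m y my.
have [d' /= d'0 ad'] := (abs_cvgP CpV _ _ _).1 (padic_pow_cvg y aP) e e0.
have dd' : 0 < Num.min d d' by rewrite lt_min d0 d'0.
have [n] := padic_int_nat_dense p_prime y dd'; rewrite lt_min => /andP[nd nd'].
apply: (nabsB_lt CpV) (ad' n nd'); apply: ad; rewrite -(subrKA y).
by apply: pabsD_lt => //; rewrite pabs_distC.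
Qed.

Lemma padic_pow_nat a m : padic_base a -> padic_pow a (m%:R : padic_int C) =
  a ^+ m.
Proof.
move=> aP; apply/esym/(nabs_eq_dist CpV) => e e0.
by have [d d0] := padic_pow_approx aP e0; apply;
  rewrite subrr (nabs0 (completion_abs (QpP C))).
Qed.

Lemma padic_pow_abs a y : padic_base a -> Cp_abs (padic_pow a y) = 1.
Proof.
move=> aP; have [d d0 ad] := padic_pow_approx aP ltr01.
have [m /ad] := padic_int_nat_dense p_prime y d0.
have am : Cp_abs (a ^+ m) = 1 by rewrite (nabsX CpV) (padic_base_abs aP) expr1n.
by rewrite -{1}am (nabs_distC CpV) => /(nabsD_eq CpV); rewrite addrC subrK am.
Qed.

Lemma padic_powD a x y : padic_base a ->
  padic_pow a (x + y) = padic_pow a x * padic_pow a y.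
Proof.
move=> aP; apply: (nabs_eq_dist CpV) => e e0.
have [d d0 ad] := padic_pow_approx aP e0.
have [m mx] := padic_int_nat_dense p_prime x d0.
have [n ny] := padic_int_nat_dense p_prime y d0.
apply: (nabsB_lt CpV (y := a ^+ (m + n))).
  by rewrite (nabs_distC CpV); apply: ad; rewrite natrD opprD addrACA pabsD_lt.
have -> : a ^+ (m + n) - padic_pow a x * padic_pow a y =
    a ^+ m * (a ^+ n - padic_pow a y) + (a ^+ m - padic_pow a x) * padic_pow a
      y.
  by rewrite exprD; ring.
apply: (nabsD_lt CpV); rewrite (nabsM CpV).
  by rewrite (nabsX CpV) (padic_base_abs aP) expr1n mul1r ad.
by rewrite padic_pow_abs // mulr1 ad.
Qed.

Lemma padic_pow_neq0 a y : padic_base a -> padic_pow a y != 0.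
Proof. by move=> aP; rewrite -(nabs_eq0 CpV) padic_pow_abs ?oner_neq0. Qed.

Lemma padic_pow0 a : padic_base a -> padic_pow a (0 : padic_int C) = 1.
Proof. exact: (@padic_pow_nat a 0). Qed.

Lemma padic_pow1 a : padic_base a -> padic_pow a (1 : padic_int C) = a.
Proof. exact: (@padic_pow_nat a 1). Qed.

Lemma padic_powN a y : padic_base a -> padic_pow a (- y) = (padic_pow a y)^-1.
Proof.
move=> aP; apply: (mulfI (padic_pow_neq0 y aP)).
by rewrite -padic_powD // subrr padic_pow0 // mulfV // padic_pow_neq0.
Qed.

Lemma padic_powV a y : padic_base a -> padic_pow a^-1 y = (padic_pow a y)^-1.
Proof.
move=> aP; have aVP := padic_baseV aP; have a0 := padic_base_neq0 aP.
have py0 := padic_pow_neq0 y aP.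
apply: (nabs_eq_dist CpV) => e e0.
have [d1 d10 ad1] := padic_pow_approx aP e0.
have [d2 d20 ad2] := padic_pow_approx aVP e0.
have d0 : 0 < Num.min d1 d2 by rewrite lt_min d10 d20.
have [m] := padic_int_nat_dense p_prime y d0; rewrite lt_min => /andP[m1 m2].
apply: (nabsB_lt CpV (y := a^-1 ^+ m)); first by rewrite (nabs_distC CpV) ad2.
(* A difference of inverses is, up to factors of absolute value 1, the difference itself. *)
have -> : a^-1 ^+ m - (padic_pow a y)^-1 =
    (a ^+ m)^-1 * (padic_pow a y)^-1 * (padic_pow a y - a ^+ m).
  by rewrite exprVn; field; rewrite py0 expf_neq0.
rewrite !(nabsM CpV) !(nabsV CpV) padic_pow_abs // (nabsX CpV) (padic_base_abs
  aP).
by rewrite expr1n !invr1 !mul1r (nabs_distC CpV) ad1.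
Qed.

Lemma padic_pow_int a (h : int) : padic_base a ->
  padic_pow a (h%:~R : padic_int C) = a ^ h.
Proof.
move=> aP; case: h => n; first by rewrite -exprnP -pmulrn padic_pow_nat.
by rewrite NegzE mulrNz -pmulrn padic_powN // padic_pow_nat // -exprnN.
Qed.

End PadicPowers.

(** With [m = p ^ N] and [k = p], this compares the alternating sums of levels [N.+1] and [N]. *)
Lemma sum_nat_mul (V : nmodType) (F : nat -> V) m k :
  \sum_(0 <= x < m * k) F x = \sum_(0 <= j < k) \sum_(0 <= x < m) F (x + m *
    j)%N.
Proof.
elim: k => [|k IHk]; first by rewrite muln0 !big_geq.
rewrite mulnS addnC (big_cat_nat (n :=
  m * k)) ?leq_addr //= IHk big_nat_recr //=.
by rewrite -{1}(add0n (m * k)%N) big_addn addKn.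
Qed.

Lemma sum_sign (K : pzRingType) n : \sum_(0 <= j < n) (-1) ^+ j =
  (odd n)%:R :> K.
Proof.
elim: n => [|n IHn]; first by rewrite big_geq.
rewrite big_nat_recr //= IHn -signr_odd; case: (odd n) => /=.
  by rewrite expr1 subrr.
by rewrite add0r.
Qed.

(** * The alternating integral: existence, shift, reflection, linearity, and its relation to
    mu_{-q} *)

Section AlternatingIntegral.
Context (R : realType) (p : nat) (p_prime : prime p) (p_odd : odd p).
Context (C : padic_complex R p).
Implicit Types (x y z : padic_int C) (N : nat) (a c : C) (f g : padic_int C ->
  C).

Let CpV := completion_abs (CpP C).

(** The bound is recorded because closure under products relies on it. *)
Definition bounded_ucont f :=
  (exists B, forall x, Cp_abs (f x) <= B) /\
  forall e, 0 < e -> exists2 d, 0 < d & forall x y,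
    Qp_abs (val (x - y)) < d -> Cp_abs (f x - f y) < e.

Lemma ucont_cst c : bounded_ucont (fun=> c).
Proof.
split=> [|e e0]; first by exists (Cp_abs c).
by exists 1 => // x y _; rewrite subrr (nabs0 CpV).
Qed.

Lemma ucontD f g : bounded_ucont f -> bounded_ucont g ->
  bounded_ucont (fun x => f x + g x).
Proof.
move=> [[A fA] fc] [[B gB] gc]; split=> [|e e0].
  exists (Num.max A B) => x; apply: (nabsD_le CpV).
    by rewrite le_max fA.
  by rewrite le_max gB orbT.
have [d1 d10 fd] := fc e e0; have [d2 d20 gd] := gc e e0.
exists (Num.min d1 d2) => [|x y]; rewrite lt_min ?d10 // => /andP[xy1 xy2].
by rewrite opprD addrACA; apply: (nabsD_lt CpV); [apply: fd | apply: gd].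
Qed.

Lemma ucontM f g : bounded_ucont f -> bounded_ucont g ->
  bounded_ucont (fun x => f x * g x).
Proof.
move=> [[A fA] fc] [[B gB] gc].
have A1 : 0 < Num.max A 1 by rewrite lt_max ltr01 orbT.
have B1 : 0 < Num.max B 1 by rewrite lt_max ltr01 orbT.
have {}fA x : Cp_abs (f x) <= Num.max A 1 by rewrite le_max fA.
have {}gB x : Cp_abs (g x) <= Num.max B 1 by rewrite le_max gB.
split=> [|e e0].
  exists (Num.max A 1 * Num.max B 1) => x.
  by rewrite (nabsM CpV) ler_pM ?(nabs_ge0 CpV).
have [d1 d10 fd] := fc (e / Num.max B 1) (divr_gt0 e0 B1).
have [d2 d20 gd] := gc (e / Num.max A 1) (divr_gt0 e0 A1).
exists (Num.min d1 d2) => [|x y]; rewrite lt_min ?d10 // => /andP[xy1 xy2].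
have -> : f x * g x - f y * g y = f x * (g x - g y) + (f x - f y) * g y by ring.
apply: (nabsD_lt CpV); rewrite (nabsM CpV).
  rewrite (le_lt_trans (ler_wpM2r _ (fA x))) ?(nabs_ge0 CpV) // mulrC.
  by rewrite -ltr_pdivlMr // gd.
rewrite (le_lt_trans (ler_wpM2l _ (gB y))) ?(nabs_ge0 CpV) //.
by rewrite -ltr_pdivlMr // fd.
Qed.

Lemma ucontX f n : bounded_ucont f -> bounded_ucont (fun x => f x ^+ n).
Proof.
move=> fc; elim: n => [|n IHn]; first exact: ucont_cst.
by under eq_fun do rewrite exprS; apply: ucontM.
Qed.

(** Translations, reflections and multiplications by p-adic integers do not increase distances, so
    [f] keeps its modulus of continuity. *)
Lemma ucont_comp f (s : padic_int C -> padic_int C) :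
  (forall x y, Qp_abs (val (s x - s y)) <= Qp_abs (val (x - y))) ->
  bounded_ucont f -> bounded_ucont (fun x => f (s x)).
Proof.
move=> sle [[A fA] fc]; split=> [|e e0]; first by exists A.
have [d d0 fd] := fc e e0.
by exists d => // x y xy; apply: fd; apply: le_lt_trans (sle x y) xy.
Qed.

Lemma ucont_shift f z : bounded_ucont f -> bounded_ucont (fun x => f (x + z)).
Proof. by apply: ucont_comp => x y; rewrite opprD addrACA subrr addr0. Qed.

Lemma ucont_refl f z : bounded_ucont f -> bounded_ucont (fun x => f (z - x)).
Proof. by apply: ucont_comp => x y; rewrite opprB addrC subrKA pabs_distC. Qed.

Lemma ucont_scale f z : bounded_ucont f -> bounded_ucont (fun x => f (z * x)).
Proof. by apply: ucont_comp => x y; rewrite -mulrBr pabsMl_le. Qed.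

Lemma ucont_pow a : padic_base a -> bounded_ucont (padic_pow a).
Proof.
move=> aP; split=> [|e e0]; first by exists 1 => x; rewrite padic_pow_abs.
have [d d0 ad] := padic_pow_approx p_prime aP e0; exists d => // x y xy.
have [m mx] := padic_int_nat_dense p_prime x d0.
apply: (nabsB_lt CpV (y := a ^+ m)); first by rewrite (nabs_distC CpV) ad.
by rewrite ad // -(subrKA x) pabsD_lt.
Qed.

(** For [a = 1] this is the isometric embedding of Z_p; otherwise it is an affine function of
    [padic_pow a]. *)
Lemma ucont_qnumber a : padic_base a -> bounded_ucont (qnumber a).
Proof.
move=> aP; have [->|a1] := eqVneq a 1.
  rewrite /qnumber eqxx; split=> [|e e0].
    by exists 1 => x; rewrite Cp_abs_padic_int padic_int_abs_le1.
  by exists e => // x y; rewrite -Cp_of_padic_intB Cp_abs_padic_int.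
have -> : @qnumber R p C a = fun x => (1 - padic_pow a x) / (1 - a).
  by apply/funext => x; rewrite /qnumber (negbTE a1).
apply: (ucontM _ (ucont_cst _)); apply: (ucontD (ucont_cst _)).
by under eq_fun do rewrite -mulN1r; apply: (ucontM (ucont_cst _));
  apply: ucont_pow.
Qed.

Definition alt_sum f N := \sum_(0 <= x < p ^ N) f x%:R * (-1) ^+ x.

(** This is the integral with respect to mu_{-1}: at [Q = 1] the normalising factor of
    [fermionic_int] is 1. *)
Definition alt_int f : C := Cp_lim \oo (alt_sum f).

Lemma ucont_dist_pow f : bounded_ucont f -> forall e, 0 < e -> exists N0,
  forall N x y, (N0 <= N)%N -> Cp_abs (f (x + (p ^ N)%:R * y) - f x) < e.
Proof.
move=> [_ fc] e e0; have [d d0 fd] := fc e e0.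
have [N0 N0d] := expr_eventually_lt (pinv_lt1 R p_prime) d0.
exists N0 => N x y NN0; apply: fd; rewrite addrC addKr mulrC.
by rewrite (le_lt_trans (pabsMl_le _ _)) // pabs_natX // N0d.
Qed.

Lemma alt_sum_cvg f : bounded_ucont f ->
  abs_cvg (@Cp_abs R p C) \oo (alt_sum f) (alt_int f).
Proof.
move=> fc; suff [l fl] : exists l, abs_cvg (@Cp_abs R p C) \oo (alt_sum f) l.
  by rewrite /alt_int (Cp_lim_unique _ fl).
apply: (completion_complete (CpP C)); apply: (nabs_cauchy CpV) => e e0.
have [N0 fN0] := ucont_dist_pow fc e0; exists N0 => N N0N.
(* As p is odd, the signs add up to 1. The copy of index [j] is then compared with the block of
   [x + p ^ N * j] in the next sum, which carries the same sign because [p ^ N] is odd. *)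
have -> : alt_sum f N = \sum_(0 <= j < p) (-1) ^+ j * alt_sum f N.
  by rewrite -mulr_suml sum_sign p_odd mul1r.
rewrite /alt_sum expnSr sum_nat_mul -sumrB; apply: (nabs_sum_lt CpV) => // j.
rewrite mulr_sumr -sumrB; apply: (nabs_sum_lt CpV) => // x.
have -> : (-1) ^+ (x + p ^ N * j) = (-1) ^+ j * (-1) ^+ x :> C.
  by rewrite exprD exprM -(signr_odd _ (p ^ N)) oddX p_odd orbT expr1 mulrC.
rewrite natrD natrM mulrC [f x%:R * _]mulrC mulrA -mulrBr !(nabsM CpV) !(nabsX
  CpV).
by rewrite (nabsN CpV) (nabs1 CpV) !expr1n !mul1r fN0.
Qed.

Lemma alt_intE f l : abs_cvg (@Cp_abs R p C) \oo (alt_sum f) l -> alt_int f = l.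
Proof. exact: Cp_lim_unique. Qed.

Lemma ucont_pow_cvg f x : bounded_ucont f ->
  abs_cvg (@Cp_abs R p C) \oo (fun N => f (x + (p ^ N)%:R)) (f x).
Proof.
move=> fc; apply/(abs_cvgooP CpV) => e /(ucont_dist_pow fc)[N0 fN0].
by exists N0 => N N0N; rewrite -[(p ^ N)%:R]mulr1 fN0.
Qed.

(** Reindexing reverses the signs and leaves the end terms [f 0] and [f (p ^ N)%:R], both with sign
    plus since [p ^ N] is odd; the second tends to [f 0]. *)
Lemma alt_int_shift f : bounded_ucont f ->
  alt_int (fun x => f (x + 1)) = 2 * f 0 - alt_int f.
Proof.
move=> fc; apply: alt_intE.
have -> : alt_sum (fun x => f (x + 1)) =
    fun N => (f 0 + f (0 + (p ^ N)%:R)) + (-1) * alt_sum f N.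
  apply/funext => N; rewrite /alt_sum mulN1r.
  have eq : f 0 + \sum_(0 <= x < p ^ N) f x.+1%:R * (-1) ^+ x.+1 =
      \sum_(0 <= x < p ^ N) f x%:R * (-1) ^+ x - f (p ^ N)%:R.
    transitivity (\sum_(0 <= x < (p ^ N).+1) f x%:R * (-1) ^+ x).
      by rewrite big_nat_recl // expr0 mulr1.
    by rewrite big_nat_recr //= -(signr_odd _ (p ^ N)) oddX p_odd orbT expr1
      mulrN1.
  rewrite add0r -[X in _ - X](subrK (f (p ^ N)%:R)) -eq.
  have -> : \sum_(0 <= x < p ^ N) f (x%:R + 1) * (-1) ^+ x =
      - \sum_(0 <= x < p ^ N) f x.+1%:R * (-1) ^+ x.+1.
    by rewrite -sumrN; apply: eq_bigr => x _;
      rewrite natr1 exprS mulN1r mulrN opprK.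
  by ring.
rewrite mulr_natl -[- alt_int f]mulN1r.
apply: (abs_cvgD CpV); last by apply: (abs_cvgM CpV (abs_cvg_cst CpV _));
  apply: alt_sum_cvg.
by apply: (abs_cvgD CpV (abs_cvg_cst CpV _)); apply: ucont_pow_cvg.
Qed.

Lemma alt_int_refl f : bounded_ucont f ->
  alt_int (fun x => f (1 - x)) = alt_int f + 2 * (f 1 - f 0).
Proof.
move=> fc; have f1c := ucont_shift 1 fc.
have -> : alt_int f + 2 * (f 1 - f 0) = alt_int (fun x => f (x + 1 + 1)).
  by rewrite (alt_int_shift f1c) (alt_int_shift fc) add0r; ring.
apply: alt_intE; apply: (abs_cvg_dist0 CpV (alt_sum_cvg (ucont_shift 1 f1c))).
apply/(abs_cvgooP CpV) => e e0; have [N0 fN0] := ucont_dist_pow fc e0.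
exists N0 => N N0N; rewrite subr0 (nabs_distC CpV) /alt_sum.
(* Replacing [x] by [p ^ N - 1 - x] turns [x + 1 + 1] into [1 - x + p ^ N] and keeps the sign, as
   [p ^ N - 1] is even. What remains is a shift by [p ^ N], made small by [ucont_dist_pow]. *)
rewrite [X in Cp_abs (X - _)]big_nat_rev add0n.
rewrite (eq_big_nat _ _ (F2 := fun x : nat => f (1 - x%:R + (p ^ N)%:R * 1) *
  (-1) ^+ x)).
  rewrite -sumrB; apply: (nabs_sum_lt CpV) => // x.
  rewrite -mulrBl (nabsM CpV) (nabsX CpV) (nabsN CpV) (nabs1 CpV) expr1n mulr1.
  exact: fN0.
move=> x /= xpN; congr (f _ * _).
  rewrite mulr1 (natrB _ xpN) -natr1; ring.
rewrite -signr_odd oddB // oddX p_odd orbT /= negbK.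
by rewrite signr_odd.
Qed.

Lemma alt_int_scale c f : bounded_ucont f ->
  alt_int (fun x => c * f x) = c * alt_int f.
Proof.
move=> fc; apply: alt_intE.
have -> : alt_sum (fun x => c * f x) = fun N => c * alt_sum f N.
  by apply/funext => N; rewrite /alt_sum mulr_sumr; apply: eq_bigr => x _;
    rewrite mulrA.
by apply: (abs_cvgM CpV (abs_cvg_cst CpV _)); apply: alt_sum_cvg.
Qed.

Lemma alt_intD f g : bounded_ucont f -> bounded_ucont g ->
  alt_int (fun x => f x + g x) = alt_int f + alt_int g.
Proof.
move=> fc gc; apply: alt_intE.
have -> : alt_sum (fun x => f x + g x) = fun N => alt_sum f N + alt_sum g N.
  by apply/funext => N; rewrite /alt_sum -big_split; apply: eq_bigr => x _;
    rewrite mulrDl.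
by apply: (abs_cvgD CpV); apply: alt_sum_cvg.
Qed.

Lemma ucont_sum (F : nat -> padic_int C -> C) n : (forall l,
  bounded_ucont (F l)) ->
  bounded_ucont (fun x => \sum_(0 <= l < n) F l x).
Proof.
move=> Fc; elim: n => [|n IHn].
  by under eq_fun do rewrite big_geq //; apply: ucont_cst.
by under eq_fun do rewrite big_nat_recr //; apply: ucontD.
Qed.

Lemma alt_int_sum (F : nat -> padic_int C -> C) n : (forall l,
  bounded_ucont (F l)) ->
  alt_int (fun x => \sum_(0 <= l < n) F l x) = \sum_(0 <= l < n) alt_int (F l).
Proof.
move=> Fc; elim: n => [|n IHn].
  (* Written as a multiple of a constant, the zero function is integrated by homogeneity. *)
  have -> : (fun x => \sum_(0 <= l < 0) F l x) = fun=> 0 * 0.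
    by apply/funext => x; rewrite big_geq // mul0r.
  by rewrite (alt_int_scale 0 (ucont_cst 0)) mul0r big_geq.
under eq_fun do rewrite big_nat_recr //.
by rewrite big_nat_recr //= -IHn; apply: alt_intD => //; apply: ucont_sum.
Qed.

(** The weight [(- a) ^+ x] splits into a sign and [a ^+ x], which joins the integrand; the
    denominator [1 + a ^+ (p ^ N)] tends to 2. *)
Lemma fermionic_intE a f : padic_base a -> bounded_ucont f ->
  fermionic_int a f = (1 + a) / 2 * alt_int (fun x => f x * padic_pow a x).
Proof.
move=> aP fc; apply: Cp_lim_unique.
have -> : (fun N => (1 + a) / (1 + a ^+ (p ^ N)) *
      \sum_(0 <= x < p ^ N) f x%:R * (- a) ^+ x) =
    fun N => (1 + a) * (1 + a ^+ (p ^ N))^-1 * alt_sum (fun x => f x *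
      padic_pow a x) N.
  apply/funext => N; congr (_ * _); apply: eq_bigr => x _.
  by rewrite padic_pow_nat // -mulrA -[- a]mulN1r exprMn mulrC [_ ^+ x *
    _]mulrC mulrC.
apply: (abs_cvgM CpV); last by apply: alt_sum_cvg; apply: ucontM => //;
  apply: ucont_pow.
apply: (abs_cvgM CpV (abs_cvg_cst CpV _)); apply/(abs_cvgooP CpV) => e e0.
have abs2 : Cp_abs (2 : C) = 1.
  rewrite Cp_abs_nat Qp_abs_nat // lognE /= p_prime; case: ifP => // pd.
  by move: p_odd; rewrite (eqP (_ : p == 2)) // -dvdn_prime2.
(* Distance below 1 from 2, whose absolute value is 1, gives the denominator absolute value 1, so
   inversion preserves the estimate. *)
have e1 : 0 < Num.min e 1 by rewrite lt_min e0 ltr01.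
have [N0 aN0] := (abs_cvgooP CpV _ _).1 aP _ e1; exists N0 => N /aN0.
rewrite lt_min => /andP[aNe aN1].
have aN : Cp_abs (1 + a ^+ (p ^ N)) = 1.
  have -> : 1 + a ^+ (p ^ N) = 2 + (a ^+ (p ^ N) - 1) by ring.
  by rewrite (nabsD_eq CpV) abs2.
have neq0 (b : C) : Cp_abs b = 1 -> b != 0.
  by move=> b1; rewrite -(nabs_eq0 CpV) b1 oner_neq0.
have -> : (1 + a ^+ (p ^ N))^-1 - 2^-1 =
    (1 + a ^+ (p ^ N))^-1 * 2^-1 * (1 - a ^+ (p ^ N)).
  by field; rewrite !neq0.
by rewrite !(nabsM CpV) !(nabsV CpV) aN abs2 !invr1 !mul1r (nabs_distC CpV).
Qed.

End AlternatingIntegral.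

(** In the binomial expansion [l] counts the factors 1, and the sign of exponent [a - l] is also
    that of [a + l]. *)
Lemma expr1BX_expand (K : comPzRingType) (X : K) a b n : (b + a = n)%N ->
  (1 - X) ^+ a * X ^+ b =
  \sum_(0 <= l < a.+1) 'C(a, l)%:R * (-1) ^+ (a + l) * X ^+ (n - l).
Proof.
move=> <-; rewrite big_mkord addrC exprDn mulr_suml;
  apply: eq_bigr => -[l] /= la _.
rewrite expr1n mulr1 (exprNn X) -addnBA // -(mulr_natl _ 'C(a, l)).
rewrite -(signr_odd _ (a - l)) -(signr_odd _ (a + l)) oddB // oddD.
by rewrite (exprD X); ring.
Qed.

(** * Special values of q-numbers and their reflection *)

Section QNumbers.
Context (R : realType) (p : nat) (p_prime : prime p) (C : padic_complex R p).
Implicit Types (y : padic_int C) (q : C).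

Lemma qnumber0 q : padic_base q -> qnumber q (0 : padic_int C) = 0.
Proof.
move=> qP; rewrite /qnumber padic_pow0 // subrr mul0r; case: eqP => // _.
exact: (Cp_of_padic_int_nat C 0).
Qed.

Lemma qnumber1 q : padic_base q -> qnumber q (1 : padic_int C) = 1.
Proof.
move=> qP; rewrite /qnumber padic_pow1 //; case: eqVneq => [_|q1].
  exact: (Cp_of_padic_int_nat C 1).
by rewrite divff // subr_eq0 eq_sym.
Qed.

Lemma qnumber2 q : padic_base q -> qnumber q (2 : padic_int C) = 1 + q.
Proof.
move=> qP; rewrite /qnumber padic_pow_nat //; case: eqVneq => [->|q1].
  exact: (Cp_of_padic_int_nat C 2).
by field; rewrite subr_eq0 eq_sym.
Qed.

(** A rational identity in [q] and [padic_pow q y] when [q] is not 1; at [q = 1] both sides are 1 -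
    y. *)
Lemma qnumber_refl q y : padic_base q -> qnumber q (1 - y) = 1 - qnumber q^-1 y.
Proof.
move=> qP; have q0 := padic_base_neq0 p_prime qP.
rewrite /qnumber invr_eq1; case: eqVneq => [_|q1].
  by rewrite Cp_of_padic_intB (Cp_of_padic_int_nat C 1).
have py0 := padic_pow_neq0 p_prime y qP.
rewrite padic_powD // padic_powN // padic_pow1 // padic_powV //.
by field; rewrite py0 q0 !subr_eq0 q1 eq_sym q1.
Qed.

End QNumbers.

(** * Integrands of the Euler numbers and of the Bernstein product *)

Section Integrands.
Context (R : realType) (p : nat) (p_prime : prime p).
Context (C : padic_complex R p).
Implicit Types (y : padic_int C) (q zeta : C) (h : int).

(** The last factor comes from the weight of mu_{-q}, so that [alt_int] applies directly;
    [bernstein_integrand] does not include it. *)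
Definition euler_integrand h n q zeta y : C :=
  qnumber q y ^+ n * padic_pow zeta y * padic_pow q ((h - 1)%:~R * y) *
    padic_pow q y.

Lemma ucont_euler h n q zeta : padic_base q -> padic_base zeta ->
  bounded_ucont (euler_integrand h n q zeta).
Proof.
move=> qP zP; do 3?apply: ucontM; try exact: ucont_pow.
  by apply: ucontX; apply: ucont_qnumber.
by apply: ucont_scale; apply: ucont_pow.
Qed.

Definition bernstein_integrand h k n1 n2 q zeta y : C :=
  bernstein k n1 y q * bernstein k n2 y q
    * padic_pow q ((h - 1)%:~R * y) * padic_pow zeta y.

Lemma ucont_bernstein h k n1 n2 q zeta : padic_base q -> padic_base zeta ->
  bounded_ucont (bernstein_integrand h k n1 n2 q zeta).
Proof.
move=> qP zP; have qVP := padic_baseV p_prime qP.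
have Bc n : bounded_ucont (fun y => bernstein k n y q).
  apply: ucontM; first apply: (ucontM (ucont_cst _)); apply: ucontX.
    exact: ucont_qnumber.
  by apply: ucont_refl; apply: ucont_qnumber.
do 3?apply: ucontM; rewrite //; try exact: ucont_pow.
by apply: ucont_scale; apply: ucont_pow.
Qed.

(** With X = [y]_{1/q}, the Bernstein factors at [1 - y] multiply to binomials times (1 - X)^(2k)
    X^(n1 + n2 - 2k). The exponentials give [q ^ h * zeta] times those of base [q^-1] and
    [zeta^-1]. *)
Lemma bernstein_integrand_refl h k n1 n2 q zeta y :
  padic_base q -> padic_base zeta -> (k <= n1)%N -> (k <= n2)%N ->
  bernstein_integrand h k n1 n2 q zeta (1 - y) * padic_pow q (1 - y) =
  \sum_(0 <= l < (2 * k).+1)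
    (q ^ h * zeta * 'C(n1, k)%:R * 'C(n2, k)%:R * 'C(2 * k, l)%:R
       * (-1) ^+ (2 * k + l))
      * euler_integrand h (n1 + n2 - l) q^-1 zeta^-1 y.
Proof.
move=> qP zP kn1 kn2; have q0 := padic_base_neq0 p_prime qP.
rewrite /bernstein_integrand /bernstein subKr qnumber_refl // /euler_integrand.
set X := qnumber q^-1 y.
rewrite mulrBr mulr1 -mulrN !padic_powD // !padic_powV // !padic_pow1 //.
rewrite padic_pow_int // mulrN !padic_powN //.
set Y := padic_pow q _; set Z := padic_pow zeta y; set W := padic_pow q y.
transitivity (q ^ h * zeta * 'C(n1, k)%:R * 'C(n2, k)%:R * Z^-1 * Y^-1 * W^-1 *
    ((1 - X) ^+ (2 * k) * X ^+ (n1 - k + (n2 - k)))).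
  have -> : q ^ h = q ^ (h - 1) * q by have := expfzDr (h - 1) 1 q0;
    rewrite subrK expr1z.
  by rewrite mul2n -addnn !exprD; ring.
have nE : (n1 - k + (n2 - k) + 2 * k = n1 + n2)%N by lia.
rewrite (expr1BX_expand (X : C) nE).
rewrite mulr_sumr; apply: eq_bigr => l _; ring.
Qed.

Context (p_odd : odd p).

Lemma euler_numberE h n q zeta : padic_base q -> padic_base zeta ->
  euler_number h n q zeta = (1 + q) / 2 * alt_int (euler_integrand h n q zeta).
Proof.
move=> qP zP; rewrite /euler_number /euler_poly.
under eq_fun do rewrite add0r.
rewrite fermionic_intE //; do 2?apply: ucontM; try exact: ucont_pow.
  by apply: ucontX; apply: ucont_qnumber.
by apply: ucont_scale; apply: ucont_pow.
Qed.

End Integrands.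

Theorem theorem8 (R : realType) (p : nat) (p_prime : prime p) (p_odd : odd p)
    (C : padic_complex R p) (q : C) (hq : Cp_abs (q - 1) < 1)
    (h : int) (zeta : C) (hzeta : Tp zeta)
    (n1 n2 k : nat) (hk : (n1 + n2 > 2 * k)%N) :
  fermionic_int q (fun x : padic_int C =>
      bernstein k n1 x q * bernstein k n2 x q
        * padic_pow q ((h - 1)%:~R * x) * padic_pow zeta x) =
  if k == 0%N then
    q ^ (h + 1) * zeta * euler_number h (n1 + n2) q^-1 zeta^-1
      + qnumber q (2%:R : padic_int C)
  else
    q ^ (h + 1) * zeta * 'C(n1, k)%:R * 'C(n2, k)%:R
      * \sum_(0 <= l < (2 * k).+1)
          'C(2 * k, l)%:R * (-1) ^+ (2 * k + l)
            * euler_number h (n1 + n2 - l) q^-1 zeta^-1.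
Proof.
have qP := padic_base_near1 p_prime hq; have zP := padic_base_Tp hzeta.
have qVP := padic_baseV p_prime qP; have zVP := padic_baseV p_prime zP.
have q0 := padic_base_neq0 p_prime qP.
have Ec l := ucont_euler p_prime h (n1 + n2 - l) qVP zVP.
have two0 : 2 != 0 :> C.
  have CpV := completion_abs (CpP C).
  rewrite -(nabs_eq0 CpV) Cp_abs_nat Qp_abs_nat // expf_neq0 // invr_eq0
    pnatr_eq0.
  by rewrite -lt0n prime_gt0.
(* The hypothesis [hk] allows [k] to exceed one of [n1], [n2]. Then [k] is nonzero, a binomial
   coefficient vanishes and both sides are 0; the truncated exponents need this separate
   treatment. *)
have [/andP[kn1 kn2]|] := boolP ((k <= n1)%N && (k <= n2)%N); last first.
  rewrite negb_and -!ltnNge => kn.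
  have CC : 'C(n1, k)%:R * 'C(n2, k)%:R = 0 :> C.
    by case/orP: kn => /bin_small ->; rewrite ?mul0r ?mulr0.
  have k0 : (k == 0)%N = false by case: (k) kn.
  rewrite k0 -[_ * 'C(n1, k)%:R * _]mulrA CC mulr0 mul0r.
  rewrite [X in fermionic_int _ X](_ : _ = fun=> 0); last first.
    apply/funext => x; rewrite /bernstein !mulrA.
    rewrite -[RHS](mulr0 (qnumber q x ^+ k * qnumber q^-1 (1 - x) ^+ (n1 - k) *
      qnumber q x ^+ k * qnumber q^-1 (1 - x) ^+ (n2 - k) *
      padic_pow q ((h - 1)%:~R * x) * padic_pow zeta x)) -CC; ring.
  rewrite fermionic_intE //; last exact: ucont_cst.
  under eq_fun do rewrite mul0r -[0](mul0r (0 : C)).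
  by rewrite (alt_int_scale p_prime p_odd 0 (ucont_cst 0)) mul0r mulr0.
rewrite -[X in fermionic_int _ X]/(bernstein_integrand h k n1 n2 q zeta).
have Bc := ucont_bernstein p_prime h k n1 n2 qP zP.
rewrite fermionic_intE //.
(* The reflection formula is applied to the reflected integrand [g], whose expansion is known; [g 1]
   and [g 0] are the values of the original integrand at 0 and 1. *)
pose g (y : padic_int C) := bernstein_integrand h k n1 n2 q zeta (1 - y) *
  padic_pow q (1 - y).
have gc : bounded_ucont g.
  by apply: ucontM; apply: ucont_refl => //; apply: ucont_pow.
have -> : alt_int (fun x => bernstein_integrand h k n1 n2 q zeta x * padic_pow
  q x) =
    alt_int (fun x => g (1 - x)).
  by congr alt_int; apply/funext => x; rewrite /g subKr.
rewrite (alt_int_refl p_prime p_odd gc).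
have gE y := bernstein_integrand_refl p_prime h y qP zP kn1 kn2.
have -> : alt_int g = \sum_(0 <= l < (2 * k).+1)
    (q ^ h * zeta * 'C(n1, k)%:R * 'C(n2, k)%:R * 'C(2 * k, l)%:R
       * (-1) ^+ (2 * k + l))
      * alt_int (euler_integrand h (n1 + n2 - l) q^-1 zeta^-1).
  rewrite /g; under eq_fun do rewrite gE.
  rewrite (alt_int_sum p_prime p_odd (F := fun l y => _)) => [|l].
    by apply: eq_bigr => l _; rewrite alt_int_scale.
  by apply: ucontM => //; apply: ucont_cst.
(* At [x = 0] the factor [0]_q to the power 2k is 0 unless [k = 0], when everything is 1. *)
have g1 : g 1 = (k == 0%N)%:R.
  rewrite /g subrr /bernstein_integrand /bernstein mulr0 subr0 !qnumber0
    ?qnumber1 //.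
  rewrite !padic_pow0 // !expr1n expr0n; case: (k) => [|k'] /=;
    last by rewrite !(mulr0,mul0r).
  by rewrite !bin0 !mulr1.
have g0 : g 0 = 0.
  rewrite /g subr0 /bernstein_integrand /bernstein subrr qnumber0 //.
  (* By [hk], at least one of [n1 - k] and [n2 - k] is positive, and that power of [0]_{1/q}
     vanishes. *)
  have [n1k|n1k] := posnP (n1 - k);
    last by rewrite (expr0n _ (n1 - k)) gtn_eqF // !(mulr0, mul0r).
  by rewrite (expr0n _ (n2 - k)) gtn_eqF ?(mulr0, mul0r) //; lia.
rewrite g1 g0 subr0.
have EE l : euler_number h (n1 + n2 - l) q^-1 zeta^-1 =
  (1 + q^-1) / 2 * alt_int (euler_integrand h (n1 + n2 - l) q^-1 zeta^-1).
  exact: euler_numberE.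
(* Since (1 + q) q^h = q^(h + 1) (1 + 1/q), the prefactor of mu_{-q} becomes the one in the Euler
   numbers of base [q^-1], and the exponent of [q] rises by one. *)
have main : (1 + q) / 2 * \sum_(0 <= l < (2 * k).+1)
    (q ^ h * zeta * 'C(n1, k)%:R * 'C(n2, k)%:R * 'C(2 * k, l)%:R
       * (-1) ^+ (2 * k + l))
      * alt_int (euler_integrand h (n1 + n2 - l) q^-1 zeta^-1) =
   q ^ (h + 1) * zeta * 'C(n1, k)%:R * 'C(n2, k)%:R
      * \sum_(0 <= l < (2 * k).+1)
          'C(2 * k, l)%:R * (-1) ^+ (2 * k + l)
            * euler_number h (n1 + n2 - l) q^-1 zeta^-1.
  rewrite !mulr_sumr; apply: eq_bigr => l _; rewrite EE expfzDr // expr1z.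
  by field; rewrite q0 two0.
(* For [k = 0] only [l = 0] survives, and the boundary term (1 + q) / 2 times 2 is [2]_q; otherwise
   that term is 0. *)
rewrite mulrDr main; case: (eqVneq k 0%N) => [->|k0] /=.
  rewrite !bin0 muln0 big_nat1 bin0 addn0 expr0 subn0 qnumber2 // !mulr1 !mul1r.
  by rewrite divfK.
by rewrite !mulr0 addr0.
Qed.
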